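(* (i) The polynomial sequence $\left\{\sum_{k=0}^n\mathrm{JS}(n,k;z)y^k\right\}_{n\geq0}$ is strongly $\{z,y\}$-log-convex. (ii) The polynomial sequence $\left\{\sum_{k=0}^n\mathrm{js}(n,k;z)y^k\right\}_{n\geq0}$ is strongly $\{z,y\}$-log-convex.
   Context: The Jacobi-Stirling numbers of the first kind $\mathrm{js}(n,k;z)$ and of the second kind $\mathrm{JS}(n,k;z)$ ($n\geq k\geq 0$) are defined by $\mathrm{js}(n,k;z)=\mathrm{js}(n-1,k-1;z)+(n-1)(n-1+z)\mathrm{js}(n-1,k;z)$ and $\mathrm{JS}(n,k;z)=\mathrm{JS}(n-1,k-1;z)+k(k+z)\mathrm{JS}(n-1,k;z)$, with $\mathrm{JS}(0,0;z)=\mathrm{js}(0,0;z)=1$ and $\mathrm{JS}(j,0;z)=\mathrm{JS}(0,j;z)=\mathrm{js}(j,0;z)=\mathrm{js}(0,j;z)=0$ for $j\geq1$. A sequence $\{f_n\}$ of polynomials in $\mathbb R_+[z,y]$ is strongly $\{z,y\}$-log-convex if $f_{k-1}f_{l+1}-f_kf_l\in\mathbb R_+[z,y]$ for all $l\geq k\geq1$. *)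

(* Defs.v *)
From mathcomp Require Export all_boot all_order all_algebra.
From mathcomp Require Export reals.

Set Implicit Arguments.
Unset Strict Implicit.
Unset Printing Implicit Defensive.

Import Order.TTheory GRing.Theory Num.Theory.

Local Open Scope ring_scope.

(* The recurrences force the value 0 whenever k > n; this covers the
   out-of-range terms JS(n - 1, n; z) and js(n - 1, n; z) that they mention. *)
Fixpoint JS2 (A : nzRingType) (n k : nat) (z : A) {struct n} : A :=
  match n, k with
  | 0, 0 => 1
  | 0, _.+1 => 0
  | _.+1, 0 => 0
  | n'.+1, k'.+1 =>
      JS2 n' k' z + k'.+1%:R * (k'.+1%:R + z) * JS2 n' k'.+1 z
  end.

Fixpoint js1 (A : nzRingType) (n k : nat) (z : A) {struct n} : A :=
  match n, k with
  | 0, 0 => 1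
  | 0, _.+1 => 0
  | _.+1, 0 => 0
  | n'.+1, k'.+1 =>
      js1 n' k' z + n'%:R * (n'%:R + z) * js1 n' k'.+1 z
  end.

(* R[z,y] is {poly {poly R}}: z is the inner variable, y the outer one. *)
Definition zvar (R : nzRingType) : {poly {poly R}} := 'X%:P.
Definition yvar (R : nzRingType) : {poly {poly R}} := 'X.

Definition JS2_poly (R : nzRingType) (n : nat) : {poly {poly R}} :=
  \sum_(k < n.+1) JS2 n k (zvar R) * yvar R ^+ k.

Definition js1_poly (R : nzRingType) (n : nat) : {poly {poly R}} :=
  \sum_(k < n.+1) js1 n k (zvar R) * yvar R ^+ k.

Definition nneg_poly2 (R : numDomainType) (p : {poly {poly R}}) : Prop :=
  forall i j : nat, 0 <= p`_i`_j.

Definition strongly_zy_log_convex (R : numDomainType)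
    (f : nat -> {poly {poly R}}) : Prop :=
  (forall n : nat, nneg_poly2 (f n)) /\
  (forall k l : nat, (1 <= k)%N -> (k <= l)%N ->
     nneg_poly2 (f k.-1 * f l.+1 - f k * f l)).

(* Main.v *)
Require Import Defs.
From mathcomp Require Import ring zify.

Set Implicit Arguments.
Unset Strict Implicit.
Unset Printing Implicit Defensive.

Import Order.TTheory GRing.Theory Num.Theory.

Local Open Scope ring_scope.

(** Write [a_k = k (k + z)].  The second-kind polynomials satisfy
    [f_(n+1) = y f_n + L f_n] with [L y^k = a_k y^k], so
    [f_n f_(l+1) - f_(n+1) f_l] is the sum over [i < j] of
    [(a_j - a_i) (JS(n,i) JS(l,j) - JS(n,j) JS(l,i)) y^(i+j)].  Here
    [a_j - a_i = (j - i) (i + j + z)], and the 2x2 minors of the triangle are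
    nonnegative because each row is the previous one times a nonnegative
    bidiagonal matrix (Cauchy-Binet).  The first-kind polynomials factor as
    [f_(n+1) = (y + a_n) f_n], which gives
    [f_n f_(l+1) - f_(n+1) f_l = (a_l - a_n) f_n f_l]. *)

Section NonnegativePolynomials.

Variable R : numDomainType.
Implicit Types p q : {poly {poly R}}.

Lemma nneg_poly2_0 : nneg_poly2 (0 : {poly {poly R}}).
Proof. by move=> i j; rewrite !coef0. Qed.

Lemma nneg_poly2D p q : nneg_poly2 p -> nneg_poly2 q -> nneg_poly2 (p + q).
Proof. by move=> hp hq i j; rewrite !coefD addr_ge0. Qed.

Lemma nneg_poly2M p q : nneg_poly2 p -> nneg_poly2 q -> nneg_poly2 (p * q).
Proof.
move=> hp hq i j; rewrite coefM coef_sum; apply: sumr_ge0 => u _.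
by rewrite coefM; apply: sumr_ge0 => v _; rewrite mulr_ge0.
Qed.

Lemma nneg_poly2_1 : nneg_poly2 (1 : {poly {poly R}}).
Proof.
by move=> i j; rewrite coef1; case: (i == 0)%N; rewrite ?coef0 // coef1 ler0n.
Qed.

Lemma nneg_poly2_nat n : nneg_poly2 (n%:R : {poly {poly R}}).
Proof.
elim: n => [|n IHn]; first exact: nneg_poly2_0.
by rewrite -natr1; apply: nneg_poly2D IHn nneg_poly2_1.
Qed.

Lemma nneg_poly2X p n : nneg_poly2 p -> nneg_poly2 (p ^+ n).
Proof.
move=> hp; elim: n => [|n IHn]; first exact: nneg_poly2_1.
by rewrite exprS; apply: nneg_poly2M.
Qed.

Lemma nneg_poly2_sum n (F : nat -> {poly {poly R}}) :
  (forall i, nneg_poly2 (F i)) -> nneg_poly2 (\sum_(i < n) F i).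
Proof.
move=> hF; apply: big_ind => //; [exact: nneg_poly2_0 | exact: nneg_poly2D].
Qed.

Lemma nneg_poly2_zvar : nneg_poly2 (zvar R).
Proof.
move=> i j; rewrite /zvar coefC; case: (i == 0)%N; last by rewrite coef0.
by rewrite coefX ler0n.
Qed.

Lemma nneg_poly2_yvar : nneg_poly2 (yvar R).
Proof.
by move=> i j; rewrite /yvar coefX; case: (i == 1)%N; rewrite ?coef0 // coef1 ler0n.
Qed.

(** Each off-diagonal term is paired with its transpose: raising the bound from [n] to [n.+1] adds
    [F n n] and the pairs [F i n + F n i] with [i < n]. *)
Lemma nneg_poly2_double_sum n (F : nat -> nat -> {poly {poly R}}) :
    (forall i, nneg_poly2 (F i i)) ->
    (forall i j, (i < j)%N -> nneg_poly2 (F i j + F j i)) ->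
  nneg_poly2 (\sum_(i < n) \sum_(j < n) F i j).
Proof.
move=> hd hF; elim: n => [|n IHn]; first by rewrite big_ord0; apply: nneg_poly2_0.
rewrite big_ord_recr /= big_ord_recr /=.
under eq_bigr do rewrite big_ord_recr /=.
rewrite big_split /= addrA -[X in X + _]addrA; apply: nneg_poly2D (hd n).
apply: nneg_poly2D IHn _; rewrite -big_split /=.
apply: big_ind => [||i _]; [exact: nneg_poly2_0 | exact: nneg_poly2D | exact: hF].
Qed.

End NonnegativePolynomials.

Section JacobiStirling.

Variable A : comNzRingType.
Implicit Type z : A.

(** The common weight of both recurrences, taken at the column index for [JS2] and at the previous
    row index for [js1]. *)
Definition js_weight z (k : nat) : A := k%:R * (k%:R + z).

Lemma js_weight0 z : js_weight z 0 = 0.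
Proof. by rewrite /js_weight mul0r. Qed.

Lemma js_weightB z i j : (i <= j)%N ->
  js_weight z j - js_weight z i = (j - i)%:R * ((i + j)%:R + z).
Proof. by move=> le_ij; rewrite /js_weight natrB // natrD; ring. Qed.

Lemma JS2_small n k z : (n < k)%N -> JS2 n k z = 0.
Proof.
elim: n k => [|n IHn] [|k] //= lt_nk; rewrite !IHn ?addr0 ?mulr0 ?addr0 //.
exact: ltnW.
Qed.

Lemma js1_small n k z : (n < k)%N -> js1 n k z = 0.
Proof.
elim: n k => [|n IHn] [|k] //= lt_nk; rewrite !IHn ?addr0 ?mulr0 ?addr0 //.
exact: ltnW.
Qed.

(** The determinant on rows [n], [l] and columns [i], [j] of the triangle. *)
Definition JS2_minor z n l i j : A :=
  JS2 n i z * JS2 l j z - JS2 n j z * JS2 l i z.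

(** In terms of the previous rows, new column [k.+1] is column [k] plus [js_weight z k.+1] times
    column [k.+1]; the determinant is expanded bilinearly in its two columns. *)
Lemma JS2_minor_rec z n l i j :
  JS2_minor z n.+1 l.+1 i.+1 j.+1 =
    JS2_minor z n l i j
    + js_weight z j.+1 * JS2_minor z n l i j.+1
    + js_weight z i.+1 * JS2_minor z n l i.+1 j
    + js_weight z i.+1 * js_weight z j.+1 * JS2_minor z n l i.+1 j.+1.
Proof. by rewrite /JS2_minor /js_weight /=; ring. Qed.

End JacobiStirling.

Section Positivity.

Variable R : numDomainType.
Local Notation z := (zvar R).
Local Notation y := (yvar R).
Local Notation a := (js_weight z).

Lemma nneg_js_weight k : nneg_poly2 (a k).
Proof.
apply: nneg_poly2M; first exact: nneg_poly2_nat.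
exact: nneg_poly2D (nneg_poly2_nat _ _) (nneg_poly2_zvar R).
Qed.

Lemma nneg_js_weightB i j : (i <= j)%N -> nneg_poly2 (a j - a i).
Proof.
move=> le_ij; rewrite js_weightB //; apply: nneg_poly2M; first exact: nneg_poly2_nat.
exact: nneg_poly2D (nneg_poly2_nat _ _) (nneg_poly2_zvar R).
Qed.

Lemma nneg_JS2 n k : nneg_poly2 (JS2 n k z).
Proof.
elim: n k => [|n IHn] [|k] /=; try exact: nneg_poly2_0; first exact: nneg_poly2_1.
by apply: nneg_poly2D => //; apply: nneg_poly2M => //; apply: nneg_js_weight.
Qed.

Lemma nneg_js1 n k : nneg_poly2 (js1 n k z).
Proof.
elim: n k => [|n IHn] [|k] /=; try exact: nneg_poly2_0; first exact: nneg_poly2_1.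
by apply: nneg_poly2D => //; apply: nneg_poly2M => //; apply: nneg_js_weight.
Qed.

Lemma nneg_JS2_poly n : nneg_poly2 (JS2_poly R n).
Proof.
apply: (@nneg_poly2_sum _ _ (fun k => JS2 n k z * y ^+ k)) => k.
apply: nneg_poly2M; [exact: nneg_JS2 | exact: nneg_poly2X (nneg_poly2_yvar R)].
Qed.

Lemma nneg_js1_poly n : nneg_poly2 (js1_poly R n).
Proof.
apply: (@nneg_poly2_sum _ _ (fun k => js1 n k z * y ^+ k)) => k.
apply: nneg_poly2M; [exact: nneg_js1 | exact: nneg_poly2X (nneg_poly2_yvar R)].
Qed.

Lemma nneg_JS2_minor n l i j :
  (n <= l)%N -> (i <= j)%N -> nneg_poly2 (JS2_minor z n l i j).
Proof.
elim: n l i j => [|n IHn] l i j le_nl; rewrite leq_eqVlt => /orP[/eqP->|lt_ij];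
  try by rewrite /JS2_minor subrr; apply: nneg_poly2_0.
  (* Row 0 is 1, 0, 0, ..., and [j] is positive, so only the product with a plus sign remains. *)
  rewrite /JS2_minor [JS2 0 j z]JS2_small ?mul0r ?subr0; last exact: leq_ltn_trans lt_ij.
  exact: nneg_poly2M (nneg_JS2 _ _) (nneg_JS2 _ _).
case: l le_nl => // l le_nl; case: i j lt_ij => [|i] [|j] // lt_ij.
  (* Column 0 vanishes in every row after row 0. *)
  by rewrite /JS2_minor /= mul0r mulr0 subr0; apply: nneg_poly2_0.
rewrite JS2_minor_rec; apply: nneg_poly2D; [apply: nneg_poly2D; [apply: nneg_poly2D|]|].
- by apply: IHn => //; apply: ltnW.
- by apply: nneg_poly2M (nneg_js_weight _) _; apply: IHn; lia.
(* The columns [i.+1] and [j] may coincide here, which is why the induction allows [i <= j]. *)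
- by apply: nneg_poly2M (nneg_js_weight _) _; apply: IHn; lia.
- apply: nneg_poly2M; last by apply: IHn => //; apply: ltnW.
  exact: nneg_poly2M (nneg_js_weight _) (nneg_js_weight _).
Qed.

(** Padding with zero terms gives polynomials of different rows a common index range. *)
Lemma JS2_poly_wide N n : (n < N)%N -> JS2_poly R n = \sum_(k < N) JS2 n k z * y ^+ k.
Proof.
move=> lt_nN; rewrite /JS2_poly (big_ord_widen N (fun k => JS2 n k z * y ^+ k)) //.
rewrite [RHS](bigID (fun k : 'I_N => k < n.+1)%N) /= [X in _ + X]big1 ?addr0 //.
by move=> k; rewrite -ltnNge => lt_nk; rewrite JS2_small ?mul0r.
Qed.

Lemma JS2_polyS N n : (n < N)%N ->
  JS2_poly R n.+1 = y * JS2_poly R n + \sum_(k < N) a k * JS2 n k z * y ^+ k.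
Proof.
move=> lt_nN; rewrite (@JS2_poly_wide N.+1) // (JS2_poly_wide lt_nN).
rewrite big_ord_recl /= mul0r add0r.
under eq_bigr => k _ do rewrite /= /bump /= add1n mulrDl.
rewrite big_split /= mulr_sumr; congr (_ + _).
  by apply: eq_bigr => k _; rewrite exprS; ring.
(* The shifted sum gains its term at 0 because [a 0 = 0], and loses its term at [N] because
   [n < N]. *)
transitivity (\sum_(k < N.+1) a k * JS2 n k z * y ^+ k).
  by rewrite big_ord_recl /= js_weight0 !mul0r add0r; apply: eq_bigr => k _.
by rewrite big_ord_recr /= JS2_small // mulr0 mul0r addr0.
Qed.

Lemma JS2_poly_log_convex n l : (n <= l)%N ->
  nneg_poly2 (JS2_poly R n * JS2_poly R l.+1 - JS2_poly R n.+1 * JS2_poly R l).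
Proof.
move=> le_nl; pose N := l.+1.
have lt_nN : (n < N)%N by rewrite ltnS.
have lt_lN : (l < N)%N by [].
(* The [a j] part comes from weighting row [l], the [a i] part from weighting row [n]; the factor
   [a j - a i] changes sign under a swap of [i] and [j], so [F i j + F j i] produces a minor. *)
pose F i j := (a j - a i) * (JS2 n i z * JS2 l j z) * y ^+ (i + j).
suff -> : JS2_poly R n * JS2_poly R l.+1 - JS2_poly R n.+1 * JS2_poly R l
    = \sum_(i < N) \sum_(j < N) F i j.
  apply: nneg_poly2_double_sum => [i|i j lt_ij].
    by rewrite /F subrr !mul0r; apply: nneg_poly2_0.
  have -> : F i j + F j i = (a j - a i) * JS2_minor z n l i j * y ^+ (i + j).
    by rewrite /F /JS2_minor [(j + i)%N]addnC; ring.
  apply: nneg_poly2M (nneg_poly2X _ (nneg_poly2_yvar R)).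
  by apply: nneg_poly2M; [apply: nneg_js_weightB | apply: nneg_JS2_minor]; rewrite // ltnW.
rewrite (JS2_polyS lt_lN) (JS2_polyS lt_nN).
(* The multiplications by [y] contribute equally to both products and cancel. *)
have cross (p q u v : {poly {poly R}}) :
  p * (y * q + v) - (y * p + u) * q = p * v - u * q by ring.
rewrite cross (JS2_poly_wide lt_nN) (JS2_poly_wide lt_lN) !big_distrlr /= -sumrB.
apply: eq_bigr => i _; rewrite -sumrB; apply: eq_bigr => j _.
by rewrite /F exprD; ring.
Qed.

(** The weight depends only on the row, so it factors out of the whole sum. *)
Lemma js1_polyS n : js1_poly R n.+1 = (y + a n) * js1_poly R n.
Proof.
rewrite mulrDl /js1_poly big_ord_recl /= mul0r add0r.
under eq_bigr => k _ do rewrite /= /bump /= add1n mulrDl.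
rewrite big_split /= mulr_sumr; congr (_ + _).
  by apply: eq_bigr => k _; rewrite exprS; ring.
rewrite [in RHS]big_ord_recl big_ord_recr /= js1_small // mulr0 mul0r addr0.
(* The constant term vanishes: the weight is zero for [n = 0], and column 0 is zero for positive
   [n]. *)
rewrite [in RHS]mulrDr expr0 mulr1; have -> : a n * js1 n 0 z = 0.
  by case: n => [|n] /=; rewrite ?js_weight0 ?mul0r ?mulr0.
by rewrite add0r mulr_sumr; apply: eq_bigr => k _; rewrite -mulrA.
Qed.

Lemma js1_poly_log_convex n l : (n <= l)%N ->
  nneg_poly2 (js1_poly R n * js1_poly R l.+1 - js1_poly R n.+1 * js1_poly R l).
Proof.
move=> le_nl; rewrite !js1_polyS.
have -> : js1_poly R n * ((y + a l) * js1_poly R l)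
    - (y + a n) * js1_poly R n * js1_poly R l
    = (a l - a n) * (js1_poly R n * js1_poly R l) by ring.
apply: nneg_poly2M; first exact: nneg_js_weightB.
exact: nneg_poly2M (nneg_js1_poly _) (nneg_js1_poly _).
Qed.

End Positivity.

Theorem theorem1p4 (R : realType) :
  strongly_zy_log_convex (@JS2_poly R) /\
  strongly_zy_log_convex (@js1_poly R).
Proof.
split; split.
- exact: nneg_JS2_poly.
- by move=> [|k] l // _ lt_kl; apply: JS2_poly_log_convex; apply: ltnW.
- exact: nneg_js1_poly.
- by move=> [|k] l // _ lt_kl; apply: js1_poly_log_convex; apply: ltnW.
Qed.
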